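(* $t(3)=5$.
   Context: Let $\mathfrak{C}=\{0,1\}^n$ be the vertex set of the $n$-dimensional hypercube; $\oplus,\wedge$ denote bitwise XOR and AND. An outmap is any function $s:\mathfrak{C}\to\{0,1\}^n$. A clash of $s$ is a pair of distinct vertices $u,v$ with $(s(u)\oplus s(v))\wedge(u\oplus v)=0^n$. A query at $u$ to the oracle for $s$ returns $s(u)$; algorithms choose queries adaptively, and only the number of queries is counted. \textsc{Sink-or-Clash}: given oracle access to an arbitrary outmap $s$, query either a vertex $u$ with $s(u)=0^n$ or both vertices of some clash. $t(n)=\min_{\mathcal A}\max_s t(\mathcal A,s)$, where $\mathcal A$ ranges over deterministic algorithms solving \textsc{Sink-or-Clash} on all outmaps of the $n$-cube and $t(\mathcal A,s)$ is the number of queries made on $s$. *)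

(* Defs.v *)
From mathcomp Require Import all_boot.
From mathcomp Require Import boolp.

Set Implicit Arguments.
Unset Strict Implicit.
Unset Printing Implicit Defensive.

Notation cube n := (n.-tuple bool).

Definition zero_bits n : cube n := [tuple false | i < n].
Definition xor_bits n (u v : cube n) : cube n :=
  [tuple tnth u i (+) tnth v i | i < n].
Definition and_bits n (u v : cube n) : cube n :=
  [tuple tnth u i && tnth v i | i < n].

Notation outmap n := {ffun cube n -> cube n}.

Definition sink n (s : outmap n) (u : cube n) : Prop := s u = zero_bits n.

Definition clash n (s : outmap n) (u v : cube n) : Prop :=
  u <> v /\ and_bits (xor_bits (s u) (s v)) (xor_bits u v) = zero_bits n.

(* A deterministic adaptive algorithm is a decision tree: it either halts, or
   queries a vertex and continues depending on the answer.  Being inductive, it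
   halts on every outmap. *)
Inductive algorithm (n : nat) : Type :=
| Halt
| Query (u : cube n) (next : cube n -> algorithm n).

Arguments Halt {n}.

Fixpoint queried n (A : algorithm n) (s : outmap n) : seq (cube n) :=
  match A with
  | Halt => [::]
  | Query u next => u :: queried (next (s u)) s
  end.

(* Repeated queries are counted with multiplicity. *)
Definition num_queries n (A : algorithm n) (s : outmap n) : nat :=
  size (queried A s).

Definition solves_sink_or_clash n (A : algorithm n) : Prop :=
  forall s : outmap n,
    (exists2 u, u \in queried A s & sink s u) \/
    (exists u v, [/\ u \in queried A s, v \in queried A s & clash s u v]).

Definition worst_case n (A : algorithm n) : nat :=
  \max_(s : outmap n) num_queries A s.

Definition attainable n (k : nat) : Prop :=
  exists A : algorithm n, solves_sink_or_clash A /\ worst_case A = k.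

Fixpoint query_all n (r : seq (cube n)) : algorithm n :=
  if r is u :: r' then Query u (fun _ => query_all r') else Halt.

Lemma queried_query_all n (r : seq (cube n)) (s : outmap n) :
  queried (query_all r) s = r.
Proof. by elim: r => //= u r ->. Qed.

(* An outmap without clash is injective, hence bijective, hence has a sink. *)
Lemma query_all_solves n : solves_sink_or_clash (query_all (enum {: cube n})).
Proof.
move=> s; rewrite queried_query_all.
have [inj_s | /injectivePn[u [v neq_uv eq_s]]] := boolP (injectiveb s).
  have [g _ gK] := injF_bij (injectiveP _ inj_s).
  by left; exists (g (zero_bits n)); [rewrite mem_enum | exact: gK].
right; exists u, v; split; rewrite ?mem_enum //; split; first exact/eqP.
by apply: eq_from_tnth => i; rewrite !tnth_mktuple eq_s addbb.
Qed.

Lemma attainable_ex n : exists k, `[< attainable n k >].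
Proof.
exists (worst_case (query_all (enum {: cube n}))); apply/asboolP.
by exists (query_all (enum {: cube n})); split=> //; exact: query_all_solves.
Qed.

(* The minimum, over all algorithms A solving Sink-or-Clash on the n-cube, of
   max_s (num_queries A s). *)
Definition t (n : nat) : nat := ex_minn (attainable_ex n).

(* Main.v *)
(** The answers given so far on a set of queried vertices are undecided when
    they contain neither a sink nor a clash.  A player choosing vertices then
    faces an adversary choosing answers that keep the position undecided, and
    [t n <= k] holds exactly when the player wins within [k] moves.  For
    [n = 3] this finite game is evaluated: the player wins in 5 moves but not
    in 4. *)

Require Import Defs.
From mathcomp Require Import all_boot.
From mathcomp Require Import boolp.

Set Implicit Arguments.
Unset Strict Implicit.
Unset Printing Implicit Defensive.

(* The game is played on plain bit sequences because tuples and finite functions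
   do not reduce in the kernel. *)
Fixpoint bitseqs (n : nat) : seq bitseq :=
  if n is m.+1 then [seq b :: r | b <- [:: true; false], r <- bitseqs m]
  else [:: [::]].

Definition separates (u v a b : bitseq) : bool :=
  has (fun i => (nth false a i (+) nth false b i)
                && (nth false u i (+) nth false v i)) (iota 0 (size u)).

(** A vertex may be chosen again, but must then receive its old answer, so the answers in a history
    stay consistent with a single outmap. *)
Definition legal (h : seq (bitseq * bitseq)) (u a : bitseq) : bool :=
  has id a
  && all (fun p => if p.1 == u then p.2 == a else separates p.1 u p.2 a) h.

(** Victory is detected at the move that causes it: an answer that is not [legal] ends the game at
    once. Play thus continues only from undecided positions, and having no move left is a loss. *)
Fixpoint win (n k : nat) (h : seq (bitseq * bitseq)) : bool :=
  if k is m.+1 then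
    has (fun u => all (fun a => legal h u a ==> win n m ((u, a) :: h))
                      (bitseqs n)) (bitseqs n)
  else false.

Definition history n (s : outmap n) (us : seq (cube n)) :
  seq (bitseq * bitseq) := [seq (val u, val (s u)) | u <- us].

Definition settled n (s : outmap n) (us : seq (cube n)) : Prop :=
  (exists2 u, u \in us & sink s u) \/
  (exists u v, [/\ u \in us, v \in us & clash s u v]).

Lemma mem_bitseqs n (r : bitseq) : (r \in bitseqs n) = (size r == n).
Proof.
elim: n r => [|n IHn] [|b r] //.
  by apply/negP => /allpairsPdep[c [r' []]].
rewrite eqSS -IHn; apply/allpairsPdep/idP => [[c [r' [_ r'P [_ ->]]]] //|rP].
by exists b, r; split; case: b.
Qed.

Lemma bitseqsP n (r : bitseq) :
  reflect (exists u : cube n, r = u) (r \in bitseqs n).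
Proof.
rewrite mem_bitseqs; apply: (iffP idP) => [rn|[u ->]]; last by rewrite size_tuple.
by exists (Tuple rn).
Qed.

Lemma sinkE n (s : outmap n) (u : cube n) : sink s u <-> ~~ has id (s u).
Proof.
split=> [-> | /hasPn su0].
  by apply/hasPn => b /tnthP[i ->]; rewrite tnth_mktuple.
apply: eq_from_tnth => i; rewrite tnth_mktuple.
exact/negbTE/su0/mem_tnth.
Qed.

Lemma clashE n (s : outmap n) (u v : cube n) :
  clash s u v <-> u != v /\ ~~ separates u v (s u) (s v).
Proof.
rewrite /clash /separates size_tuple; split=> [[/eqP uv suv]|[uv /hasPn suv]].
  split=> //; apply/hasPn => i; rewrite mem_iota add0n => /= lt_in.
  have /= := congr1 (fun w : cube n => tnth w (Ordinal lt_in)) suv.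
  by rewrite !tnth_mktuple !(tnth_nth false) => ->.
split; first exact/eqP.
apply: eq_from_tnth => i; rewrite !tnth_mktuple !(tnth_nth false).
by apply/negbTE/suv; rewrite mem_iota /= add0n.
Qed.

Lemma clash_sym n (s : outmap n) (u v : cube n) : clash s u v -> clash s v u.
Proof.
case=> uv suv; split=> [vu|]; first by apply: uv.
rewrite -suv; apply: eq_from_tnth => i; rewrite !tnth_mktuple.
by congr (_ && _); rewrite addbC.
Qed.

Lemma settledS n (s : outmap n) (us vs : seq (cube n)) :
  {subset us <= vs} -> settled s us -> settled s vs.
Proof.
move=> us_vs [[u /us_vs uP us0]|[u [v [/us_vs uP /us_vs vP uv]]]].
  by left; exists u.
by right; exists u, v.
Qed.

Lemma legalP n (s : outmap n) (us : seq (cube n)) (u : cube n) :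
  legal (history s us) u (s u) <->
  ~ sink s u /\ {in us, forall v, ~ clash s v u}.
Proof.
rewrite /legal all_map; split=> [/andP[su /allP sep]|[su sep]].
  split=> [/sinkE/negP//|v /sep /= sep_v /clashE[vu /negP]].
  by rewrite val_eqE (negPf vu) in sep_v.
apply/andP; split; first by apply/negPn/negP => /sinkE.
apply/allP => v /sep vu /=; rewrite val_eqE; have [-> //|neq_vu] := eqVneq v u.
by apply/negPn/negP => nsep; apply: vu; apply/clashE.
Qed.

Lemma settled_cons n (s : outmap n) (us : seq (cube n)) (u : cube n) :
  settled s (u :: us) <-> ~~ legal (history s us) u (s u) \/ settled s us.
Proof.
split; last case=> [/negP nleg|]; last by apply: settledS => v; rewrite inE orbC => ->.
  move=> set_us; have [/legalP[su leg]|] := boolP (legal _ _ _); last by left.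
  right; case: set_us => [[v]|[v [w []]]].
    by rewrite inE => /predU1P[-> //|vP sv]; left; exists v.
  rewrite !inE => /predU1P[->|vP] /predU1P[->|wP] vw.
  - by case: vw.
  - by case: (leg w wP); apply: clash_sym.
  - by case: (leg v vP).
  - by right; exists v, w.
apply: contrapT => nset; apply: nleg; apply/legalP; split=> [su|v vP vu].
  by apply: nset; left; exists u; rewrite ?mem_head.
by apply: nset; right; exists v, u; rewrite !inE vP eqxx orbT.
Qed.

Lemma settled_cat_cons n (s : outmap n) (us vs : seq (cube n)) (u : cube n) :
  settled s (us ++ u :: vs) <-> settled s ((u :: us) ++ vs).
Proof. by split; apply: settledS => v; rewrite !(mem_cat, inE) -orbA orbCA. Qed.

Lemma win_strategy n k (h : seq (bitseq * bitseq)) : win n k h ->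
  exists A : algorithm n, forall (s : outmap n) us, h = history s us ->
    num_queries A s <= k /\ settled s (us ++ queried A s).
Proof.
elim: k h => //= k IHk h /hasP[_ /bitseqsP[u ->] /allP win_u].
have answer (a : cube n) : exists B : algorithm n,
    forall (s : outmap n) us, h = history s us -> s u = a ->
    num_queries B s <= k /\ settled s ((u :: us) ++ queried B s).
  have /implyP := win_u a (introT (bitseqsP n a) (ex_intro _ a erefl)).
  case: (boolP (legal h u a)) => [_ /(_ isT)/IHk[B BP]|nleg _].
    by exists B => s us hE sua; apply: BP; rewrite hE -sua.
  exists Halt => s us hE sua; split=> //; rewrite cats0; apply/settled_cons.
  by left; rewrite -hE sua.
have [next nextP] := choice answer.
exists (Query u next) => s us hE; have [lek set_us] := nextP _ s us hE erefl.
by split; [exact: lek | apply/settled_cat_cons].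
Qed.

(** Induction on the tree: at each query the adversary redefines [s] at that vertex by a legal
    answer from which the player still loses. Agreement on [us] keeps the earlier answers
    truthful. *)
Lemma lose_adversary n (A : algorithm n) k (s : outmap n) us :
  ~~ win n k (history s us) -> ~ settled s us ->
  exists2 s' : outmap n, {in us, s' =1 s} &
    num_queries A s' <= k -> ~ settled s' (us ++ queried A s').
Proof.
elim: A k s us => [|u next IH] k s us lose nset.
  by exists s => //= _; rewrite cats0.
case: k lose => [_|k /hasPn lose]; first by exists s.
have /allPn[_ /bitseqsP[a ->]] := lose u (introT (bitseqsP n u) (ex_intro _ u erefl)).
rewrite negb_imply => /andP[leg lose_a].
pose s1 : outmap n := [ffun v => if v == u then a else s v].
have s1u : s1 u = a by rewrite ffunE eqxx.
have s1s : {in us, s1 =1 s}.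
  move=> v vP; rewrite ffunE; case: eqP => // vu.
  (* If [u] was queried before, legality forces [a] to be the old answer. *)
  case/andP: leg => _ /allP/(_ _ (map_f _ vP)) /=.
  by rewrite vu eqxx => /eqP/val_inj.
have hist1 : history s1 us = history s us by apply/eq_in_map => v /s1s ->.
have nset1 : ~ settled s1 us.
  move=> set1; apply: nset; case: set1 => [[v vP]|[v [w [vP wP]]]].
    by rewrite /sink s1s // => sv; left; exists v.
  by rewrite /clash !s1s // => vw; right; exists v, w.
have lose1 : ~~ win n k (history s1 (u :: us)) by rewrite /= s1u hist1.
have [|s' s's1 s'P] := IH a k s1 (u :: us) lose1.
  by case/settled_cons=> //; rewrite s1u hist1 leg.
have s'u : s' u = a by rewrite s's1 ?mem_head.
exists s' => [v vP|]; first by rewrite s's1 ?s1s // inE vP orbT.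
rewrite /num_queries /= s'u ltnS => /s'P nset'; apply: contra_not nset'.
by move/settled_cat_cons.
Qed.

Lemma leq_t_win n k : (t n <= k) = win n k [::].
Proof.
rewrite /t; case: ex_minnP => m /asboolP[A [solA mA]] min_m; apply/idP/idP.
  move=> le_mk; apply: contraT => lose.
  (* Nothing has been queried yet, so any initial outmap will do. *)
  have [|s _] := @lose_adversary n A k [ffun=> zero_bits n] [::] lose.
    by case=> [[u]|[u [v []]]].
  case/(_ _)/(_ (solA s)); apply: leq_trans le_mk.
  by rewrite -mA; apply: (leq_bigmax s).
(* The strategy may need fewer than [k] queries, so minimality is applied to its exact worst
   case. *)
case/win_strategy=> A' A'P; apply: (@leq_trans (worst_case A')).
  apply/min_m/asboolP; exists A'; split=> // s.
  by have [] := A'P s [::] erefl.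
by apply/bigmax_leqP => s _; have [] := A'P s [::] erefl.
Qed.

Theorem lemma24 : t 3 = 5.
Proof.
(* The lower bound, read as [4 < t 3], becomes the failure of [win 3 4 [::]]. *)
apply/eqP; rewrite eqn_leq ltnNge !leq_t_win.
(* Lazy evaluation is essential: the search relies on short-circuiting, which
   [vm_compute] does not do. *)
by lazy.
Qed.
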